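(* Let $A\in\mathbb{C}^{n\times n}$ with $\operatorname{ind}(A)=k$, let $X$ be a minimal rank weak Drazin inverse of $A$, and let $Y\in\mathbb{C}^{n\times n}$. The following statements are equivalent: (1) $Y=A^{\dagger}AXAA^{\dagger}$; (2) $AY=P_{\mathcal{R}(A^k),\,\mathcal{N}(XAA^{\dagger})}$, $YA=P_{\mathcal{R}(A^{\dagger}A^k),\,\mathcal{N}(XA)}$, and $YAY=Y$; (3) $AY=P_{\mathcal{R}(A^k),\,\mathcal{N}(XAA^{\dagger})}$, $YA=P_{\mathcal{R}(A^{\dagger}A^k),\,\mathcal{N}(XA)}$, and $\operatorname{rank}(Y)=\operatorname{rank}(A^k)$.
   Context: $A^{\dagger}$ is the Moore–Penrose inverse of $A$; $\mathcal{R}(\cdot)$ and $\mathcal{N}(\cdot)$ denote range and null space; $P_{\mathcal{S},\mathcal{T}}$ denotes the (oblique) projector onto $\mathcal{S}$ along $\mathcal{T}$, where $\mathbb{C}^n=\mathcal{S}\oplus\mathcal{T}$. The index $\operatorname{ind}(A)$ is the smallest nonnegative integer $k$ such that $\operatorname{rank}(A^k)=\operatorname{rank}(A^{k+1})$. $A^{D}$ is the Drazin inverse of $A$: the unique $T$ with $TAT=T$, $AT=TA$, $A^{k+1}T=A^k$ where $k=\operatorname{ind}(A)$. A matrix $X\in\mathbb{C}^{n\times n}$ is a minimal rank weak Drazin inverse of $A$ if $XA^{j+1}=A^{j}$ for some $j\in\mathbb{N}$ and $\operatorname{rank}(X)=\operatorname{rank}(A^{D})$. For a fixed such $X$, $A^{\dagger}AXAA^{\dagger}$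 is called the weak CMP inverse of $A$. *)

(* Defs.v *)
From HB Require Import structures.
From mathcomp Require Import all_boot all_order all_algebra.
From mathcomp Require Import complex reals.

Set Implicit Arguments.
Unset Strict Implicit.
Unset Printing Implicit Defensive.

Import GRing.Theory Num.Theory.
Local Open Scope ring_scope.
Local Open Scope sesquilinear_scope.

(* Uniqueness and existence (as a^k z a^k, with z an inner inverse of         *)
(* a^(2k+1)) of the Drazin inverse, in a ring.                                *)
Section RingDrazin.
Variable R : pzRingType.
Implicit Types a s t u v z : R.

Lemma ring_drazin_uniq a s t k :
    s * a * s = s -> a * s = s * a -> a ^+ k.+1 * s = a ^+ k ->
    t * a * t = t -> a * t = t * a -> a ^+ k.+1 * t = a ^+ k ->
  s = t.
Proof.
move=> ds cs ks dt ct kt.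
have sa_idem j : (s * a) ^+ j.+1 = s * a.
  by elim: j => [|j IHj]; rewrite ?expr1// exprS IHj mulrA ds.
have at_idem j : (a * t) ^+ j.+1 = a * t.
  by elim: j => [|j IHj]; rewrite ?expr1// exprS IHj -mulrA (mulrA t) dt.
have ssa j : s * (s * a) ^+ j = s.
  by case: j => [|j]; rewrite ?mulr1// sa_idem -cs mulrA.
have att j : (a * t) ^+ j * t = t.
  by case: j => [|j]; rewrite ?mul1r// at_idem ct.
have sE : s = s * a * t.
  rewrite -(sa_idem k) exprMn_comm; last exact: commr_sym.
  by rewrite -mulrA kt exprS -mulrA -exprMn_comm ?ssa//; exact: commr_sym.
have tE : t = s * a * t.
  rewrite -mulrA -(at_idem k) exprMn_comm // mulrA.
  have -> : s * a ^+ k.+1 = a ^+ k.+1 * s by apply: commrX; apply: commr_sym.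
  by rewrite ks exprSr mulrA -exprMn_comm // att.
by rewrite sE -tE.
Qed.

Lemma ring_drazin_exists a u v z k (m := (k + k.+1)%N) :
    a ^+ k = a ^+ m * u -> a ^+ k = v * a ^+ m ->
    a ^+ m * z * a ^+ m = a ^+ m ->
  let t := a ^+ k * z * a ^+ k in
  [/\ t * a * t = t, a * t = t * a & a ^+ k.+1 * t = a ^+ k].
Proof.
move=> au av az t.
have atE : a * t = a ^+ k.+1 * u.
  rewrite /t {2}au exprS {1}av -!mulrA; congr (a * _).
  by rewrite (mulrA _ z) (mulrA _ (a ^+ m)) az mulrA -av.
have aau : a ^+ k * a = a ^+ m * (a * u).
  by rewrite -exprSr exprS {1}au !mulrA -exprS exprSr.
have taE : t * a = v * a ^+ k.+1.
  by rewrite /t -mulrA aau {1}av [LHS]mulrA -!(mulrA v) az -aau -exprSr.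
have vu : a ^+ k.+1 * u = v * a ^+ k.+1.
  by rewrite exprSr {1}av -!mulrA (mulrA _ a) -exprSr exprS -mulrA -au -exprS
    -exprSr.
have ta : a * t = t * a by rewrite atE taE.
split=> //; last by rewrite exprSr -mulrA atE mulrA -exprD -au.
by rewrite -mulrA atE [LHS]mulrA -(mulrA _ (a ^+ k)) -exprD -mulrA -au.
Qed.

End RingDrazin.

Section Index.
Variables (F : fieldType) (n : nat).
Implicit Types A T : 'M[F]_n.

Lemma index_exists A : exists k, \rank (A ^+ k) == \rank (A ^+ k.+1).
Proof.
have [/existsP[k rk]|] :=
    boolP [exists k : 'I_n.+1, \rank (A ^+ k) == \rank (A ^+ k.+1)].
  by exists k.
rewrite negb_exists => /forallP rkN.
have rk_le k : (k <= n.+1)%N -> (\rank (A ^+ k) + k <= n)%N.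
  elim: k => [|k IHk] lekn; first by rewrite addn0 rank_leq_row.
  rewrite addnS (leq_trans _ (IHk (ltnW lekn))) // -addSn leq_add2r.
  rewrite ltn_neqAle eq_sym (rkN (Ordinal lekn)) exprS.
  exact: mxrankM_maxr.
by have := leq_trans (leq_addl _ _) (rk_le _ (leqnn n.+1)); rewrite ltnn.
Qed.

Definition mxindex A : nat := ex_minn (index_exists A).

Lemma mxindexP A : \rank (A ^+ mxindex A) = \rank (A ^+ (mxindex A).+1).
Proof. by rewrite /mxindex; case: ex_minnP => k /eqP. Qed.

Definition is_drazin A T : bool :=
  [&& T *m A *m T == T, A *m T == T *m A &
      A ^+ (mxindex A).+1 *m T == A ^+ mxindex A].

Lemma drazin_exists A : exists T, is_drazin A T.
Proof.
set k := mxindex A.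
have /submxP[v vE] : (A ^+ k <= A ^+ k.+1)%MS.
  have lek : (A ^+ k.+1 <= A ^+ k)%MS by rewrite exprS submxMl.
  by rewrite -(geq_leqif (mxrank_leqif_sup lek)) mxindexP.
have /submxP[w wE] : ((A ^+ k)^T <= (A ^+ k.+1)^T)%MS.
  have lek : ((A ^+ k.+1)^T <= (A ^+ k)^T)%MS.
    by rewrite exprSr trmx_mul submxMl.
  by rewrite -(geq_leqif (mxrank_leqif_sup lek)) !mxrank_tr mxindexP.
have {}wE : A ^+ k = A ^+ k.+1 * w^T by rewrite -[LHS]trmxK wE trmx_mul !trmxK.
have {}vE : A ^+ k = v * A ^+ k.+1 := vE.
have vj j : A ^+ k = v ^+ j * A ^+ (k + j).
  elim: j => [|j IHj]; first by rewrite mul1r addn0.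
  by rewrite exprSr -addSnnS (exprD _ k.+1) -mulrA (mulrA v) -vE -exprD.
have wj j : A ^+ k = A ^+ (k + j) * w^T ^+ j.
  elim: j => [|j IHj]; first by rewrite mulr1 addn0.
  rewrite exprS -addSnnS addnC exprD -mulrA (mulrA (A ^+ k.+1)) -wE.
  by rewrite mulrA -exprD addnC.
pose m := (k + k.+1)%N.
have [d c e] := ring_drazin_exists (wj k.+1) (vj k.+1)
  (mulmxKpV (submx_refl (A ^+ m))).
by exists (A ^+ k * pinvmx (A ^+ m) * A ^+ k); apply/and3P; split; apply/eqP.
Qed.

Definition drazin A : 'M[F]_n := xchoose (drazin_exists A).

Lemma drazinP A : is_drazin A (drazin A).
Proof. exact: xchooseP. Qed.

Lemma drazin_uniq A T : is_drazin A T -> T = drazin A.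
Proof.
case/and3P=> /eqP d1 /eqP c1 /eqP k1.
case/and3P: (drazinP A) => /eqP d2 /eqP c2 /eqP k2.
exact: (ring_drazin_uniq d1 c1 k1 d2 c2 k2).
Qed.

End Index.

Section MoorePenrose.
Variable C : numClosedFieldType.

Definition is_mpinv m n (A : 'M[C]_(m, n)) (T : 'M[C]_(n, m)) : bool :=
  [&& A *m T *m A == A, T *m A *m T == T,
      (A *m T)^t* == A *m T & (T *m A)^t* == T *m A].

Lemma trmxC_mul m n p (A : 'M[C]_(m, n)) (B : 'M_(n, p)) :
  (A *m B)^t* = B^t* *m A^t*.
Proof. by rewrite trmx_mul map_mxM. Qed.

Lemma trmxC_sandwich m n (B : 'M[C]_(m, n)) (M : 'M[C]_n) :
  M^t* = M -> (B *m M *m B^t*)^t* = B *m M *m B^t*.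
Proof. by move=> hM; rewrite !trmxC_mul trmxCK hM mulmxA. Qed.

Lemma mulmx_trmxC_eq0 m n (A : 'M[C]_(m, n)) : A *m A^t* = 0 -> A = 0.
Proof.
move/orthomx1P/orthomx_disj => AA0; apply/eqP; rewrite -submx0 -AA0.
by rewrite sub_capmx submx_refl.
Qed.

Lemma gram_unitmx m n (G : 'M[C]_(m, n)) : row_free G -> G *m G^t* \in unitmx.
Proof.
move=> freeG; rewrite -row_free_unit -kermx_eq0; apply/eqP.
set K := kermx _; have KG0 : K *m (G *m G^t*) = 0 by rewrite mulmx_ker.
have: K *m G = 0.
  by apply: mulmx_trmxC_eq0; rewrite trmxC_mul mulmxA -(mulmxA K) KG0 mul0mx.
by move/eqP; rewrite mulmx_free_eq0 // => /eqP.
Qed.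

(* MacDuffee's formula for a full-rank factorization *)
Lemma full_rank_mpinv m n r (F : 'M[C]_(m, r)) (G : 'M_(r, n)) :
    row_full F -> row_free G ->
  is_mpinv (F *m G)
    (G^t* *m invmx (G *m G^t*) *m (invmx (F^t* *m F) *m F^t*)).
Proof.
move=> fullF freeG; set A := F *m G.
have uG : G *m G^t* \in unitmx by apply: gram_unitmx.
have uF : F^t* *m F \in unitmx.
  rewrite -{2}[F]trmxCK; apply: gram_unitmx.
  by rewrite /row_free mxrank_map mxrank_tr.
set F' := invmx (F^t* *m F) *m F^t*; set G' := G^t* *m invmx (G *m G^t*).
have F'F : F' *m F = 1%:M by rewrite -mulmxA mulVmx.
have GG' : G *m G' = 1%:M by rewrite mulmxA mulmxV.
have invC p (M : 'M[C]_p) : (invmx M)^t* = invmx (M^t*).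
  by rewrite trmx_inv map_invmx.
have AT : A *m (G' *m F') = F *m F'.
  by rewrite /A -mulmxA (mulmxA G) GG' mul1mx.
have TA : (G' *m F') *m A = G' *m G.
  by rewrite /A -mulmxA (mulmxA F') F'F mul1mx.
apply/and4P; split; apply/eqP.
- by rewrite AT {1}/A mulmxA -(mulmxA F) F'F mulmx1.
- by rewrite TA mulmxA -(mulmxA G') GG' mulmx1.
- by rewrite AT mulmxA trmxC_sandwich // invC trmxC_mul trmxCK.
- rewrite TA; have := @trmxC_sandwich _ _ (G^t*) (invmx (G *m G^t*)).
  by rewrite trmxCK; apply; rewrite invC trmxC_mul trmxCK.
Qed.

Lemma mpinv_exists m n (A : 'M[C]_(m, n)) : exists T, is_mpinv A T.
Proof.
have := full_rank_mpinv (col_base_full A) (row_base_free A).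
by rewrite mulmx_base => ?; eexists; eassumption.
Qed.

Definition mpinv m n (A : 'M[C]_(m, n)) : 'M[C]_(n, m) :=
  xchoose (mpinv_exists A).

Lemma mpinvP m n (A : 'M[C]_(m, n)) : is_mpinv A (mpinv A).
Proof. exact: xchooseP. Qed.

Lemma mpinv_uniq m n (A : 'M[C]_(m, n)) T : is_mpinv A T -> T = mpinv A.
Proof.
case/and4P=> /eqP a1 /eqP a2 /eqP a3 /eqP a4.
case/and4P: (mpinvP A); set S := mpinv A => /eqP b1 /eqP b2 /eqP b3 /eqP b4.
have ATS : A *m T = A *m S.
  by rewrite -[in LHS]b1 -(mulmxA (A *m S)) -{1}b3 -{1}a3 -trmxC_mul
    mulmxA a1 b3.
have TSA : T *m A = S *m A.
  by rewrite -[in LHS]b1 -!mulmxA mulmxA -{1}a4 -{1}b4 -trmxC_mul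
    -(mulmxA S) (mulmxA A) a1 b4.
by rewrite -a2 TSA -mulmxA ATS mulmxA b2.
Qed.

End MoorePenrose.

Section RangeNull.
Variable F : fieldType.

(* Matrices act on column vectors, so these are the column space and the     *)
(* right kernel, not the row-space notions of mxalgebra.                      *)
Definition mxrange m n (A : 'M[F]_(m, n)) : {vspace 'cV[F]_m} :=
  limg (linfun (mulmx A : 'cV[F]_n -> 'cV[F]_m)).

Definition mxnull m n (A : 'M[F]_(m, n)) : {vspace 'cV[F]_n} :=
  lker (linfun (mulmx A : 'cV[F]_n -> 'cV[F]_m)).

Lemma mxrangeP m n (A : 'M[F]_(m, n)) (y : 'cV[F]_m) :
  reflect (exists x : 'cV[F]_n, y = A *m x) (y \in mxrange A).
Proof.
apply: (iffP memv_imgP) => [[x _ ->]|[x ->]]; exists x; rewrite ?lfunE//.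
exact: memvf.
Qed.

Lemma mem_mxnull m n (A : 'M[F]_(m, n)) (x : 'cV[F]_n) :
  (x \in mxnull A) = (A *m x == 0).
Proof. by rewrite memv_ker lfunE. Qed.

(* "P = P_{S,T}"; the condition F^n = S (+) T is part of the assertion. *)
Definition is_projector n (P : 'M[F]_n) (S T : {vspace 'cV[F]_n}) : Prop :=
  [/\ (S + T)%VS = fullv, (S :&: T)%VS = 0%VS,
      forall x, x \in S -> P *m x = x & forall x, x \in T -> P *m x = 0].

Definition is_min_rank_weak_drazin n (A X : 'M[F]_n) : Prop :=
  (exists j : nat, X *m A ^+ j.+1 = A ^+ j) /\ \rank X = \rank (drazin A).

End RangeNull.

(* Main.v *)
(* Writing M for the Moore-Penrose inverse and k for the index of A, the     *)
(* hypotheses on X amount to X A^(k+1) = A^k and X = A^k Z for some Z, so     *)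
(* that X A X = X. This gives (1) => (2) by direct computation. A projector   *)
(* is determined by its range and null space, so (2) or (3) forces AY and YA  *)
(* to be those of Y1 = M A X A M; rank Y = rank (AY) gives Y = YAY, and then  *)
(* Y = (YA)Y = Y1 (AY) = Y1 A Y1 = Y1.                                        *)
Require Import Defs.
From mathcomp Require Import all_boot all_order all_algebra.
From mathcomp Require Import complex reals.

Import GRing.Theory.

Local Open Scope ring_scope.

(** Minimality of rank turns the one-sided identity on [X] into the equality of the column spaces of
    [X] and [A ^+ k] ([weak_drazin_factor]), whence [X] is an outer inverse of [A]. Cancelling the
    Moore-Penrose factors, the two products of the weak CMP inverse with [A] both factor through and
    fix the required ranges and kernels, so [is_projector_range_null] applies. Conversely the two
    projectors, with outerness, determine [Y]; the rank condition recovers outerness by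
    [outer_inverse_rank]. *)

Section Projector.
Context {F : fieldType}.

Lemma mulmx_col_ext {m n} {A B : 'M[F]_(m, n)} :
  (forall x : 'cV_n, A *m x = B *m x) -> A = B.
Proof.
move=> eqAB; apply/matrixP => i j.
by have /colP/(_ i) := eqAB (delta_mx j 0); rewrite -!colE !mxE.
Qed.

Lemma is_projector_uniq {n} {P Q : 'M[F]_n} {S T} :
  is_projector P S T -> is_projector Q S T -> P = Q.
Proof.
move=> [ST _ PS PT] [_ _ QS QT]; apply: mulmx_col_ext => x.
have /memv_addP[s sS [t tT ->]] : x \in (S + T)%VS by rewrite ST memvf.
by rewrite !mulmxDr PS // QS // PT // QT.
Qed.

(** The factorizations and the fixing identities identify the range and kernel of [P]; the splitting
    is x = P x + (x - P x). *)
Lemma is_projector_range_null {m p n} {P : 'M[F]_n} {B : 'M_(n, m)}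
    {C : 'M_(p, n)} {V W} :
    P = B *m V -> P = W *m C -> P *m B = B -> C *m P = C ->
  is_projector P (mxrange B) (mxnull C).
Proof.
move=> PV PW PB CP.
have fixP x : x \in mxrange B -> P *m x = x.
  by case/mxrangeP=> y ->; rewrite mulmxA PB.
have killP x : x \in mxnull C -> P *m x = 0.
  by rewrite mem_mxnull PW -mulmxA => /eqP->; rewrite mulmx0.
split=> //; apply/eqP.
  rewrite eqEsubv subvf; apply/subvP=> x _.
  rewrite -(subrKC (P *m x) x); apply: memv_add.
    by apply/mxrangeP; exists (V *m x); rewrite PV mulmxA.
  by rewrite mem_mxnull mulmxBr mulmxA CP subrr.
rewrite -subv0; apply/subvP=> x /memv_capP[/fixP Px /killP].
by rewrite Px => ->; rewrite mem0v.
Qed.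

End Projector.

Section WeakDrazin.
Context {F : fieldType} {n : nat}.
Implicit Types A X : 'M[F]_n.

(** Trades [A ^+ k] for any higher power, which bridges the arbitrary exponent in the weak Drazin
    condition and the index. *)
Lemma mxindex_drazin_exp A j :
  A ^+ mxindex A = A ^+ (j + mxindex A) *m drazin A ^+ j.
Proof.
have /and3P[_ _ /eqP] := drazinP A; rewrite !mulmxE => dk.
elim: j => [|j IHj]; first by rewrite mulr1.
rewrite addSnnS exprD (exprS (drazin A)) mulrA -(mulrA (A ^+ j)).
by rewrite dk -exprD.
Qed.

(** Each matrix is a multiple of the other: with D the Drazin inverse, A^k = A^(k+1) D and D =
    D^(k+1) A^k. *)
Lemma mxrank_drazin A : \rank (drazin A) = \rank (A ^+ mxindex A).
Proof.
have /and3P[] := drazinP A; rewrite !mulmxE => /eqP dd /eqP dc /eqP dk.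
apply/eqP; rewrite eqn_leq -{2}dk mxrankM_maxr andbT.
have dX j : drazin A = drazin A ^+ j.+1 * A ^+ j.
  elim: j => [|j IHj]; first by rewrite mulr1.
  rewrite exprS (exprSr A) !mulrA -(mulrA (drazin A)) -IHj.
  by rewrite -mulrA -dc -[LHS]dd mulrA.
by rewrite {1}(dX (mxindex A)) mxrankM_maxr.
Qed.

Lemma weak_drazin_index {A X} :
    is_min_rank_weak_drazin A X ->
  X *m A ^+ (mxindex A).+1 = A ^+ mxindex A.
Proof.
case=> -[j Xj] _; rewrite exprS {1}(mxindex_drazin_exp A j).
rewrite [in RHS](mxindex_drazin_exp A j) exprD -{2}Xj exprS.
by rewrite !mulmxE !mulrA.
Qed.

Lemma weak_drazin_factor {A X} :
  is_min_rank_weak_drazin A X -> exists Z, X = A ^+ mxindex A *m Z.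
Proof.
move=> hX; have XA := weak_drazin_index hX.
(* Transposes are needed since [<=] compares row spaces; equal ranks reverse the inclusion. *)
have sub : ((A ^+ mxindex A)^T <= X^T)%MS by rewrite -XA trmx_mul submxMl.
have : (X^T <= (A ^+ mxindex A)^T)%MS.
  by rewrite -(geq_leqif (mxrank_leqif_sup sub)) !mxrank_tr hX.2 mxrank_drazin.
case/submxP=> Z XZ; exists Z^T.
by rewrite -[X]trmxK XZ trmx_mul trmxK.
Qed.

Lemma weak_drazin_outer {A X} : is_min_rank_weak_drazin A X -> X *m A *m X = X.
Proof.
move=> hX; have [Z XZ] := weak_drazin_factor hX.
by rewrite {2 3}XZ mulmxA -(mulmxA X) mulmxE -exprS -mulmxE weak_drazin_index.
Qed.

Lemma mulmx_weak_drazin_exp {A X} :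
    is_min_rank_weak_drazin A X ->
  A *m X *m A ^+ mxindex A = A ^+ mxindex A.
Proof.
move=> /weak_drazin_index Xk; have Ak := mxindex_drazin_exp A 1.
rewrite [in LHS]Ak mulmxA -(mulmxA A) add1n Xk mulmxE -exprS.
by rewrite [in RHS]Ak.
Qed.

End WeakDrazin.

Definition weak_cmp {C : numClosedFieldType} {n} (A X : 'M[C]_n) : 'M_n :=
  mpinv A *m A *m X *m A *m mpinv A.

Section WeakCMP.
Context {C : numClosedFieldType} {n : nat} {A X : 'M[C]_n}.
Hypothesis hX : is_min_rank_weak_drazin A X.
Let k := mxindex A.
Let M := mpinv A.
Let Y := weak_cmp A X.

Let AMA : A *m M *m A = A.
Proof. by have /and4P[/eqP] := mpinvP A. Qed.

Let XAX : X *m A *m X = X. Proof. exact: weak_drazin_outer. Qed.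

Let AXAk : A *m X *m A ^+ k = A ^+ k.
Proof. exact: mulmx_weak_drazin_exp. Qed.

Let AMAk : A *m M *m A ^+ k = A ^+ k.
Proof. by rewrite -AXAk !mulmxA AMA. Qed.

Let AXAMAk : A *m X *m A *m M *m A ^+ k = A ^+ k.
Proof. by rewrite -(mulmxA (A *m X)) -(mulmxA (A *m X)) AMAk. Qed.

Lemma mulmx_weak_cmp : A *m Y = A *m X *m A *m M.
Proof. by rewrite /Y /weak_cmp !mulmxA AMA. Qed.

Lemma weak_cmp_mulmx : Y *m A = M *m A *m X *m A.
Proof. by rewrite /Y /weak_cmp -2!mulmxA (mulmxA A) AMA. Qed.

Let AXE : exists V, A *m X = A ^+ k *m V.
Proof.
have [Z ->] := weak_drazin_factor hX; exists (A *m Z).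
by rewrite !mulmxA !mulmxE -exprS -exprSr.
Qed.

Lemma mxrank_mulmx_weak_cmp : \rank (A *m Y) = \rank (A ^+ k).
Proof.
have [V AX] := AXE; rewrite mulmx_weak_cmp; apply/eqP; rewrite eqn_leq.
apply/andP; split; first by rewrite AX -!mulmxA mxrankM_maxl.
by rewrite -{1}AXAMAk mxrankM_maxl.
Qed.

Lemma mulmx_weak_cmp_projector :
  is_projector (A *m Y) (mxrange (A ^+ k)) (mxnull (X *m A *m M)).
Proof.
have [V AX] := AXE; rewrite mulmx_weak_cmp.
apply: (is_projector_range_null (V := V *m A *m M) (W := A)).
- by rewrite AX !mulmxA.
- by rewrite !mulmxA.
- exact: AXAMAk.
- by rewrite !mulmxA -(mulmxA X) -(mulmxA X) AMA XAX mulmxA.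
Qed.

Lemma weak_cmp_mulmx_projector :
  is_projector (Y *m A) (mxrange (M *m A ^+ k)) (mxnull (X *m A)).
Proof.
have [V AX] := AXE; rewrite weak_cmp_mulmx.
apply: (is_projector_range_null (V := V *m A) (W := M *m A)).
- by rewrite -(mulmxA M) AX !mulmxA.
- by rewrite !mulmxA.
- by rewrite -[in RHS]AXAMAk !mulmxA.
- by rewrite !mulmxA -(mulmxA X) -(mulmxA X) AMA XAX.
Qed.

Lemma weak_cmp_outer : Y *m A *m Y = Y.
Proof.
rewrite weak_cmp_mulmx -(mulmxA _ A) mulmx_weak_cmp.
rewrite /Y /weak_cmp !mulmxA -(mulmxA (M *m A) X A) -(mulmxA (M *m A) (X *m A) X).
by rewrite XAX !mulmxA.
Qed.

End WeakCMP.

(** Equal ranks make the row spaces of [Y] and [A *m Y] coincide, so Y = U A Y for some U, and the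
    idempotent A Y is absorbed on the right. *)
Lemma outer_inverse_rank {F : fieldType} {n} {A Y : 'M[F]_n} :
  A *m Y *m (A *m Y) = A *m Y -> \rank Y = \rank (A *m Y) -> Y *m A *m Y = Y.
Proof.
move=> AYAY rkY.
have : (Y <= A *m Y)%MS.
  by rewrite -(geq_leqif (mxrank_leqif_sup (submxMl A Y))) rkY.
by case/submxP=> U YU; rewrite -mulmxA {1}YU -(mulmxA U) AYAY -YU.
Qed.

Lemma weak_cmp_projector_tfae {C : numClosedFieldType} {n : nat}
    {A X : 'M[C]_n} (Y : 'M[C]_n) :
  let k := mxindex A in
  is_min_rank_weak_drazin A X ->
  [<-> Y = weak_cmp A X;
       [/\ is_projector (A *m Y)
             (mxrange (A ^+ k)) (mxnull (X *m A *m mpinv A)),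
           is_projector (Y *m A)
             (mxrange (mpinv A *m A ^+ k)) (mxnull (X *m A))
         & Y *m A *m Y = Y];
       [/\ is_projector (A *m Y)
             (mxrange (A ^+ k)) (mxnull (X *m A *m mpinv A)),
           is_projector (Y *m A)
             (mxrange (mpinv A *m A ^+ k)) (mxnull (X *m A))
         & \rank Y = \rank (A ^+ k)]].
Proof.
move=> k hX; have pAY := mulmx_weak_cmp_projector hX.
have pYA := weak_cmp_mulmx_projector hX.
have rkAY := mxrank_mulmx_weak_cmp hX.
have YAY := weak_cmp_outer hX.
tfae=> [-> | [AY YA outerY] | [AY YA rkY]].
- by split; [exact: pAY | exact: pYA | exact: YAY].
- split; [exact: AY | exact: YA | rewrite -rkAY -(is_projector_uniq AY pAY)].
  (* Y = Y (A Y) bounds the rank of Y by that of A Y. *)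
  apply/eqP; rewrite eqn_leq mxrankM_maxr andbT.
  by rewrite -{1}outerY -mulmxA mxrankM_maxr.
have eAY := is_projector_uniq AY pAY; have eYA := is_projector_uniq YA pYA.
have outerY : Y *m A *m Y = Y.
  apply: outer_inverse_rank; last by rewrite eAY rkAY.
  by rewrite eAY -mulmxA (mulmxA (weak_cmp _ _)) YAY.
(* Replace Y A, then A Y, by the products of the weak CMP inverse. *)
by rewrite -outerY eYA -mulmxA eAY mulmxA YAY.
Qed.

Theorem proposition2p7 (R : realType) (n k : nat) (A X Y : 'M[R[i]]_n)
    (hk : mxindex A = k) (hX : is_min_rank_weak_drazin A X) :
  [<-> (* (1) *)
       Y = mpinv A *m A *m X *m A *m mpinv A;
       (* (2) *)
       [/\ is_projector (A *m Y)
             (mxrange (A ^+ k)) (mxnull (X *m A *m mpinv A)),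
           is_projector (Y *m A)
             (mxrange (mpinv A *m A ^+ k)) (mxnull (X *m A))
         & Y *m A *m Y = Y];
       (* (3) *)
       [/\ is_projector (A *m Y)
             (mxrange (A ^+ k)) (mxnull (X *m A *m mpinv A)),
           is_projector (Y *m A)
             (mxrange (mpinv A *m A ^+ k)) (mxnull (X *m A))
         & \rank Y = \rank (A ^+ k)]].
Proof. subst k; exact: weak_cmp_projector_tfae. Qed.
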